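(* Let $R$ be a Noetherian Jacobson ring. If $A \subset B$ are subfinite $R$-algebras ($A$ an $R$-subalgebra of $B$), then $$\dim A \le \dim B.$$
   Context: All rings and algebras are commutative with identity; $\dim$ denotes Krull dimension. A ring $R$ is a Jacobson ring if every prime ideal of $R$ is an intersection of maximal ideals. An $R$-algebra is called subfinite if it is a subalgebra of a finitely generated $R$-algebra (it need not itself be finitely generated). *)

(* Defs.v *)
From HB Require Import structures.
From mathcomp Require Import all_boot all_order all_algebra zify.
From mathcomp Require Import boolp classical_sets constructive_ereal.

Set Implicit Arguments.
Unset Strict Implicit.
Unset Printing Implicit Defensive.

Import Order.TTheory GRing.Theory Num.Theory.
Local Open Scope classical_set_scope.
Local Open Scope ring_scope.

(* Rings are [comPzRingType]s, so that the zero ring is allowed.  The ideals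
   of ring_quotient.v and the algebras of ssralg.v exclude it: ideals are
   therefore defined below as classical sets, and an R-algebra is a ring A
   with a structure morphism {rmorphism R -> A}. *)

Section Ideals.
Variable A : comPzRingType.
Implicit Types I J P M : set A.

Definition is_ideal I : Prop :=
  [/\ I 0, forall x y, I x -> I y -> I (x + y) & forall a x, I x -> I (a * x)].

Definition prime_ideal P : Prop :=
  [/\ is_ideal P, ~ P 1 & forall x y, P (x * y) -> P x \/ P y].

Definition maximal_ideal M : Prop :=
  [/\ is_ideal M, ~ M 1
    & forall J, is_ideal J -> ~ J 1 -> M `<=` J -> J = M].

Definition fg_ideal I : Prop :=
  exists (n : nat) (g : 'I_n -> A),
    I = [set x | exists c : 'I_n -> A, x = \sum_(i < n) c i * g i].

(* There is a chain P_0 < P_1 < ... < P_n of n + 1 prime ideals. *)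
Definition has_prime_chain (n : nat) : Prop :=
  exists P : nat -> set A,
    (forall i, (i <= n)%N -> prime_ideal (P i)) /\
    (forall i, (i < n)%N -> P i `<` P i.+1).

End Ideals.

Definition noetherian (A : comPzRingType) : Prop :=
  forall I : set A, is_ideal I -> fg_ideal I.

Definition jacobson (A : comPzRingType) : Prop :=
  forall P : set A, prime_ideal P ->
    exists2 F : set (set A), F `<=` @maximal_ideal A & P = \bigcap_(M in F) M.

Definition chain_lengths (A : comPzRingType) : set (\bar int) :=
  [set (n%:Z)%:E | n in @has_prime_chain A].

(* The value is -oo for the zero ring and +oo when the chain lengths are
   unbounded; [krull_dimP] shows that the supremum always exists, so the
   default value of [supremum] is only used for the zero ring. *)
Definition krull_dim (A : comPzRingType) : \bar int :=
  supremum (-oo)%E (chain_lengths A).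

Definition fg_algebra (R C : comPzRingType) (phi : {rmorphism R -> C}) : Prop :=
  exists s : seq C, forall S : set C,
    subring_closed [in S] -> (forall r, S (phi r)) -> (forall x, x \in s -> S x) ->
    S = setT.

Definition subfinite (R A : comPzRingType) (phi : {rmorphism R -> A}) : Prop :=
  exists (C : comPzRingType) (psi : {rmorphism R -> C}) (j : {rmorphism A -> C}),
    [/\ fg_algebra psi, (forall r, j (phi r) = psi r) & injective j].

Lemma krull_dimP (A : comPzRingType) :
  supremums (chain_lengths A) (krull_dim A).
Proof.
rewrite /krull_dim /supremum; case: ifPn => [/eqP -> | /set0P [x0 x0S]].
  by split=> [x []|x _]; rewrite ?leNye.
case: xgetP => [x _ //|nosup]; exfalso.
have [[m mub]|unb] :=
    pselect (exists m : nat, forall n, has_prime_chain A n -> (n <= m)%N).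
  have exn : exists n, `[< has_prime_chain A n >].
    by case: x0S => n nA _; exists n; apply/asboolP.
  have ubn n : `[< has_prime_chain A n >] -> (n <= m)%N by move/asboolP/mub.
  case: (ex_maxnP exn ubn) => n /asboolP nA nmax.
  apply: (nosup (n%:Z)%:E); split=> [_ [k kA <-]|y yub].
    by rewrite lee_fin lez_nat; apply: nmax; apply/asboolP.
  by apply: yub; exists n.
apply: (nosup (+oo)%E); split=> [x _|y yub]; first exact: leey.
case: y yub => [z|//|] yub.
- exfalso; apply: unb; exists `|z|%N => n nA.
  have : ((n%:Z)%:E <= z%:E)%E by apply: yub; exists n.
  by rewrite lee_fin; lia.
- by case: x0S => n nA _; have := yub _ (ex_intro2 _ _ n nA erefl).
Qed.

(* Main.v *)
Require Import Defs.
From HB Require Import structures.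
From mathcomp Require Import all_boot all_order all_algebra.
From mathcomp Require Import ring zify.
From mathcomp Require Import boolp classical_sets constructive_ereal.

Set Implicit Arguments.
Unset Strict Implicit.
Unset Printing Implicit Defensive.

Import Order.TTheory GRing.Theory Num.Theory.
Local Open Scope classical_set_scope.
Local Open Scope ring_scope.

(* Let C be a finitely generated R-algebra containing B, and let a chain of
   n + 1 primes of A be given.  Picking an element in each difference
   P_(i+1) \ P_i yields a finitely generated subalgebra A0 of A in which the
   chain stays strict; A0 is again Noetherian and Jacobson.  Some prime Q of C
   contracts into P_0, so P_0 may be replaced by the contraction p of Q.  Since
   C is finitely generated over A0, there is f in A0 \ p such that every chain
   of primes starting at p and avoiding f lifts to a chain of C starting at Q,
   which then contracts to a strict chain of B.  It remains to move the chain
   of A0 away from f: if p < q < r and f is not in p, Krull's principal ideal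
   theorem provides a prime strictly between p and r which does not contain f,
   and at the top of the chain the Jacobson property does the same. *)

Lemma least_nat (P : nat -> Prop) :
  (exists n, P n) -> exists2 n, P n & forall m, (m < n)%N -> ~ P m.
Proof.
move=> [n Pn]; have exP : exists n, `[< P n >] by exists n; apply/asboolP.
case: (ex_minnP exP) => m /asboolP Pm mmin; exists m => // k km Pk.
by have := mmin k (introT (asboolP _) Pk); rewrite leqNgt km.
Qed.

(** * Ideals of Noetherian rings *)

Section IdealTheory.
Variable A : comNzRingType.
Implicit Types (I J P Q M r : set A) (a b c x y z : A).

Section Closure.
Variables (I : set A) (iI : is_ideal I).

Lemma in_ideal0 : I 0. Proof. by case: iI. Qed.

Lemma in_idealD x y : I x -> I y -> I (x + y).
Proof. by case: iI => _ h _; apply: h. Qed.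

Lemma in_idealMl a x : I x -> I (a * x).
Proof. by case: iI => _ _; apply. Qed.

Lemma in_idealMr a x : I x -> I (x * a).
Proof. by rewrite mulrC; apply: in_idealMl. Qed.

Lemma in_idealN x : I x -> I (- x).
Proof. by rewrite -mulN1r; apply: in_idealMl. Qed.

Lemma in_idealB x y : I x -> I y -> I (x - y).
Proof. by move=> Ix /in_idealN; apply: in_idealD. Qed.

Lemma in_ideal_sum (T : Type) (s : seq T) (p : pred T) (F : T -> A) :
  (forall i, p i -> I (F i)) -> I (\sum_(i <- s | p i) F i).
Proof. by move=> h; apply: big_ind => //; [exact: in_ideal0|exact: in_idealD]. Qed.

Lemma in_idealDKr x y : I x -> I (y + x) -> I y.
Proof. by move=> Ix Iyx; rewrite -(addrK x y); apply: in_idealB. Qed.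

Lemma in_idealDKl x y : I x -> I (x + y) -> I y.
Proof. by rewrite addrC; apply: in_idealDKr. Qed.

End Closure.

Lemma prime_is_ideal P : prime_ideal P -> is_ideal P. Proof. by case. Qed.

Lemma prime_mul P x y : prime_ideal P -> ~ P x -> ~ P y -> ~ P (x * y).
Proof. by case=> _ _ h nx ny /h []. Qed.

Lemma prime_exp P x n : prime_ideal P -> ~ P x -> ~ P (x ^+ n).
Proof.
move=> pP nx; elim: n => [|n IH]; first by rewrite expr0; case: pP.
by rewrite exprS; apply: prime_mul.
Qed.

Definition ideal_adj I a : set A := [set z | exists b c, I b /\ z = b + c * a].

Lemma ideal_adjP I a : is_ideal I -> is_ideal (ideal_adj I a).
Proof.
move=> iI; split.
- by exists 0, 0; split; [exact: in_ideal0|rewrite mul0r addr0].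
- move=> _ _ [b [c [Ib ->]]] [b' [c' [Ib' ->]]].
  by exists (b + b'), (c + c'); split; [exact: in_idealD|ring].
- move=> d _ [b [c [Ib ->]]].
  by exists (d * b), (d * c); split; [exact: in_idealMl|ring].
Qed.

Lemma ideal_adj_sub I a : I `<=` ideal_adj I a.
Proof. by move=> x Ix; exists x, 0; rewrite mul0r addr0. Qed.

Lemma ideal_adj_gen I a : is_ideal I -> ideal_adj I a a.
Proof. by move=> iI; exists 0, 1; split; [exact: in_ideal0|rewrite mul1r add0r]. Qed.

Lemma ideal_adj_min I J a :
  is_ideal J -> I `<=` J -> J a -> ideal_adj I a `<=` J.
Proof.
by move=> iJ IJ Ja _ [b [c [Ib ->]]]; apply: in_idealD; [|apply: IJ|apply: in_idealMl].
Qed.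

Lemma maximal_prime M : maximal_ideal M -> prime_ideal M.
Proof.
case=> iM M1 maxM; split=> // x y Mxy.
have [Mx|Mx] := pselect (M x); [by left|right].
have [[m [c [Mm E1]]]|nMx1] := pselect (ideal_adj M x 1).
  have -> : y = y * m + c * (x * y) by rewrite -[LHS]mulr1 E1; ring.
  by apply: in_idealD => //; apply: in_idealMl.
case: Mx; rewrite -(maxM (ideal_adj M x)) //; first exact: ideal_adj_gen.
  exact: ideal_adjP.
exact: ideal_adj_sub.
Qed.

Definition ideal_colon I a : set A := [set z | I (z * a)].

Lemma ideal_colonP I a : is_ideal I -> is_ideal (ideal_colon I a).
Proof.
move=> iI; split; rewrite /ideal_colon /=.
- by rewrite mul0r; apply: in_ideal0.
- by move=> x y Ix Iy; rewrite mulrDl; apply: in_idealD.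
- by move=> b x Ix; rewrite -mulrA; apply: in_idealMl.
Qed.

Lemma ideal_colon_sub I a : is_ideal I -> I `<=` ideal_colon I a.
Proof. by move=> iI x Ix; apply: in_idealMr. Qed.

Definition generates (s : seq A) I : Prop :=
  (forall x, x \in s -> I x) /\
  (forall J, is_ideal J -> (forall x, x \in s -> J x) -> I `<=` J).

Lemma span_ideal n (g : 'I_n -> A) :
  is_ideal [set x | exists c : 'I_n -> A, x = \sum_(i < n) c i * g i].
Proof.
split; first by exists (fun=> 0); rewrite big1 // => i _; rewrite mul0r.
  move=> _ _ [c ->] [c' ->]; exists (fun i => c i + c' i).
  by rewrite -big_split; apply: eq_bigr => i _; rewrite mulrDl.
move=> a _ [c ->]; exists (fun i => a * c i).
by rewrite mulr_sumr; apply: eq_bigr => i _; rewrite mulrA.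
Qed.

Lemma span_gen n (g : 'I_n -> A) i :
  exists c : 'I_n -> A, g i = \sum_(j < n) c j * g j.
Proof.
exists (fun j => (j == i)%:R).
rewrite (bigD1 i) //= eqxx mul1r big1 ?addr0 // => j /negPf ->.
by rewrite mul0r.
Qed.

Lemma fg_idealP I : fg_ideal I <-> is_ideal I /\ exists s, generates s I.
Proof.
split.
- move=> [n [g ->]]; split; first exact: span_ideal.
  exists [seq g i | i <- enum 'I_n]; split.
    by move=> x /mapP[i _ ->]; apply: span_gen.
  move=> J iJ Jg _ [c ->]; apply: in_ideal_sum => // i _.
  by apply: in_idealMl => //; apply: Jg; apply: map_f; rewrite mem_enum.
- move=> [iI [s [Is sI]]]; exists (size s), (fun i => s`_i).
  apply/seteqP; split; last first.
    move=> _ [c ->]; apply: in_ideal_sum => // i _.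
    by apply: in_idealMl => //; apply: Is; apply: mem_nth.
  apply: sI => [|x xs]; first exact: span_ideal.
  have ix : (index x s < size s)%N by rewrite index_mem.
  by have := span_gen (fun i : 'I_(size s) => s`_i) (Ordinal ix); rewrite nth_index.
Qed.

Lemma noetherianP :
  noetherian A <-> forall I, is_ideal I -> exists s, generates s I.
Proof.
split=> h I iI; first by have /fg_idealP[] := h _ iI.
by apply/fg_idealP; split=> //; apply: h.
Qed.

Hypothesis noethA : noetherian A.

(** Otherwise choice gives a strictly increasing sequence [L] in [F]; its union is an ideal whose
    finitely many generators all lie in one [L N], against strictness. *)
Lemma noetherian_max (F : set (set A)) I : F `<=` @is_ideal A -> F I ->
  exists M, [/\ F M, I `<=` M & forall J, F J -> M `<=` J -> J = M].
Proof.
move=> idF FI; apply: contrapT => nomax.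
pose G M := F M /\ I `<=` M.
have [next nextP] : {next : set A -> set A &
    forall M, G M -> G (next M) /\ M `<` next M}.
  apply: (@choice _ _ (fun M N => G M -> G N /\ M `<` N)) => M.
  have [[FM IM]|nG] := pselect (G M); last by exists M.
  have [J [FJ [MJ JM]]] : exists J, F J /\ M `<=` J /\ J <> M.
    apply: contrapT => noJ; apply: nomax; exists M; split=> // J FJ MJ.
    by apply: contrapT => JM; apply: noJ; exists J.
  exists J => _; split; first by split=> //; apply: subset_trans MJ.
  by split=> // JM'; apply: JM; apply/seteqP.
pose L k := iter k next I.
have GL k : G (L k) by elim: k => [|k IH]; [split|case: (nextP _ IH)].
have LS k : L k `<` L k.+1 by case: (nextP _ (GL k)).
have Lmono m n : (m <= n)%N -> L m `<=` L n.
  move=> /subnKC <-; elim: (n - m)%N => [|k IH]; first by rewrite addn0.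
  by rewrite addnS; apply: subset_trans IH _; case: (LS (m + k)%N).
have iL k : is_ideal (L k) by apply: idF; case: (GL k).
pose U : set A := [set x | exists k, L k x].
have iU : is_ideal U.
  split; first by exists 0%N; apply: in_ideal0.
    move=> x y [m Lx] [n Ly]; exists (maxn m n); apply: in_idealD => //.
      by apply: Lmono Lx; rewrite leq_maxl.
    by apply: Lmono Ly; rewrite leq_maxr.
  by move=> a x [m Lx]; exists m; apply: in_idealMl.
have [s [Us sU]] := (iffLR noetherianP noethA) _ iU.
have [N sN] : exists N, forall x, x \in s -> L N x.
  elim: s Us {sU} => [|x s IH] Us; first by exists 0%N.
  have [|N sN] := IH; first by move=> y ys; apply: Us; rewrite inE ys orbT.
  have [m Lm] := Us x (mem_head _ _); exists (maxn m N) => y.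
  rewrite inE => /orP[/eqP ->|/sN Ly].
    by apply: Lmono Lm; rewrite leq_maxl.
  by apply: Lmono Ly; rewrite leq_maxr.
case: (LS N) => _; apply; apply: subset_trans (sU _ (iL N) sN).
by move=> x Lx; exists N.+1.
Qed.

Lemma noetherian_ind (G : set A -> Prop) :
  (forall I, is_ideal I -> (forall J, is_ideal J -> I `<` J -> G J) -> G I) ->
  forall I, is_ideal I -> G I.
Proof.
move=> step I iI; apply: contrapT => nGI.
have [||M [[iM nGM] _ maxM]] :=
  @noetherian_max [set J | is_ideal J /\ ~ G J] I; [by move=> J []|by []|].
apply: nGM; apply: step => // J iJ [MJ JM]; apply: contrapT => nGJ.
by apply: JM; rewrite (maxM J).
Qed.

Definition mul_closed (S : set A) : Prop :=
  S 1 /\ forall x y, S x -> S y -> S (x * y).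

(** Let [P] be maximal among the ideals disjoint from [S]. For [a] and [b] outside [P], both
    [P + (a)] and [P + (b)] meet [S]; if [a * b] were in [P], the product of two such points would
    be too. *)
Lemma prime_disjoint I (S : set A) :
  is_ideal I -> mul_closed S -> (forall x, I x -> ~ S x) ->
  exists P, [/\ prime_ideal P, I `<=` P, forall x, P x -> ~ S x
    & forall J, is_ideal J -> (forall x, J x -> ~ S x) -> P `<=` J -> J = P].
Proof.
move=> iI [S1 SM] IS.
have [||P [[iP PS] IP maxP]] :=
  @noetherian_max [set J | is_ideal J /\ forall x, J x -> ~ S x] I.
- by move=> J [].
- by [].
have adjS a : ~ P a -> exists2 x, ideal_adj P a x & S x.
  move=> Pa; apply: contrapT => noS; apply: Pa.
  rewrite -(maxP (ideal_adj P a)); first exact: ideal_adj_gen.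
    split; first exact: ideal_adjP.
    by move=> x aPx Sx; apply: noS; exists x.
  exact: ideal_adj_sub.
exists P; split=> //; last by move=> J iJ JS; apply: maxP.
split=> //; first by move=> /PS; apply.
move=> a b Pab; apply: contrapT => /not_orP[/adjS[_ [x [u [Px ->]] Sx]]].
move=> /adjS[_ [y [v [Py ->]] Sy]]; apply: (PS _ _ (SM _ _ Sx Sy)).
have -> : (x + u * a) * (y + v * b) =
  x * (y + v * b) + (u * a * y + u * v * (a * b)) by ring.
by apply: in_idealD => //; [apply: in_idealMr|apply: in_idealD => //; apply: in_idealMl].
Qed.

Lemma maximal_above I : is_ideal I -> ~ I 1 -> exists2 M, maximal_ideal M & I `<=` M.
Proof.
move=> iI I1; have [|||M [[iM M1 _] IM nM maxM]] := @prime_disjoint I [set 1] => //.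
- by split=> // x y -> ->; rewrite mulr1.
- by move=> x Ix x1; apply: I1; rewrite -x1.
exists M => //; split=> // J iJ J1 MJ; apply: maxM => // x Jx x1.
by apply: J1; rewrite -x1.
Qed.

(** Noetherian induction: if [I] is not prime, some [a * b] in [I] has both factors outside [I], and
    every prime over [I] lies over [I + (a)] or [I + (b)]. *)
Lemma finite_primes_above I : is_ideal I ->
  exists s : seq (set A), (forall Q, Q \in s -> prime_ideal Q /\ I `<=` Q) /\
    forall P, prime_ideal P -> I `<=` P -> exists2 Q, Q \in s & Q `<=` P.
Proof.
move: I; apply: noetherian_ind => I iI IH.
have [I1|I1] := pselect (I 1).
  by exists [::]; split=> // P [_ P1 _] IP;  have := P1 (IP _ I1).
have [pI|npI] := pselect (prime_ideal I).
  exists [:: I]; split=> [Q|P _ IP].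
    by rewrite inE => /eqP ->; split=> // x.
  by exists I; rewrite ?mem_head.
have [a [b [Iab Ia Ib]]] : exists a b, [/\ I (a * b), ~ I a & ~ I b].
  apply: contrapT => nab; apply: npI; split=> // a b Iab.
  by apply: contrapT => /not_orP[Ia Ib]; apply: nab; exists a, b.
have adjS c : ~ I c -> I `<` ideal_adj I c.
  move=> Ic; split; first exact: ideal_adj_sub.
  by move=> /(_ c (ideal_adj_gen _ iI)).
have [s [sI sP]] := IH _ (ideal_adjP a iI) (adjS _ Ia).
have [t [tI tP]] := IH _ (ideal_adjP b iI) (adjS _ Ib).
exists (s ++ t); split=> [Q|P pP IP].
  rewrite mem_cat => /orP[/sI|/tI] [pQ IQ]; split=> //;
  by apply: subset_trans IQ; apply: ideal_adj_sub.
have iP := prime_is_ideal pP.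
have [_ _ /(_ a b (IP _ Iab))[Pa|Pb]] := pP.
  have [|Q Qs QP] := sP P pP; first exact: ideal_adj_min.
  by exists Q; rewrite // mem_cat Qs.
have [|Q Qs QP] := tP P pP; first exact: ideal_adj_min.
by exists Q; rewrite // mem_cat Qs orbT.
Qed.

End IdealTheory.

(** * The principal ideal theorem and prime chains avoiding an element *)

Section PrincipalIdeal.
Variable A : comNzRingType.
Implicit Types (I J P Q p q r : set A) (a b c x y z : A).
Hypothesis noethA : noetherian A.

Definition min_prime_over r I : Prop :=
  forall Q, prime_ideal Q -> I `<=` Q -> Q `<=` r -> Q = r.

(** Localised at [r], the ring [A/I] is Artinian; [s] clears the denominators. Noetherian induction
    on [I]: when [I] is not prime, [L k] is controlled by [L k + (a)] and [(L k : a)], which lie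
    over the larger ideals [I + (a)] and [(I : a)]. *)
Lemma local_dcc r I : prime_ideal r -> is_ideal I -> min_prime_over r I ->
  forall L : nat -> set A, (forall k, is_ideal (L k)) ->
    (forall k, I `<=` L k) -> (forall k, L k.+1 `<=` L k) ->
  exists K, forall k, (K <= k)%N -> forall z, L k z ->
    exists2 s, ~ r s & L k.+1 (s * z).
Proof.
move=> pr; move: I; apply: (noetherian_ind noethA) => I iI IH minr L iL IL dL.
have [ir r1 _] := pr.
have [[s [Is rs]]|/forallNP Ir0] := pselect (exists s, I s /\ ~ r s).
  exists 0%N => k _ z _; exists s => //.
  by apply: in_idealMr => //; apply: IL.
have Ir : I `<=` r.
  by move=> x Ix; apply: contrapT => rx; apply: (Ir0 x).
have [pI|npI] := pselect (prime_ideal I).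
  have Ir' : I = r by apply: minr.
  have [Lr|/existsNP[K /forallNP LK]] :=
      pselect (forall k, exists s, L k s /\ ~ r s).
    exists 0%N => k _ z _; have [s [Ls rs]] := Lr k.+1; exists s => //.
    exact: in_idealMr.
  have dLK n : L (K + n)%N `<=` L K.
    elim: n => [|n IHn]; first by rewrite addn0.
    by rewrite addnS; apply: subset_trans (dL _) IHn.
  exists K => k /subnKC <- z /dLK Lz; exists 1; first by [].
  rewrite mul1r; apply: IL; rewrite Ir'.
  by apply: contrapT => rz; apply: (LK z).
have [a [b [Iab Ia Ib]]] : exists a b, [/\ I (a * b), ~ I a & ~ I b].
  apply: contrapT => nab; apply: npI; split=> //; first by move=> /Ir.
  move=> a b Iab; apply: contrapT => /not_orP[Ia Ib]; apply: nab.
  by exists a, b.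
have IaD : I `<` ideal_adj I a.
  split; first exact: ideal_adj_sub.
  by move=> /(_ a (ideal_adj_gen _ iI)).
have IaC : I `<` ideal_colon I a.
  split; first exact: ideal_colon_sub.
  by move=> /(_ b); rewrite /ideal_colon /= mulrC => /(_ Iab).
have minS J : I `<` J -> min_prime_over r J.
  by move=> [IJ _] Q pQ JQ; apply: minr => //; apply: subset_trans JQ.
have [|||K1 K1P] := IH _ (ideal_adjP a iI) IaD (minS _ IaD)
    (fun k => ideal_adj (L k) a).
- by move=> k; apply: ideal_adjP.
- move=> k; apply: ideal_adj_min (ideal_adj_gen _ _) => //.
    exact: ideal_adjP.
  by apply: subset_trans (IL k) _; apply: ideal_adj_sub.
- move=> k; apply: ideal_adj_min (ideal_adj_gen _ _) => //.
    exact: ideal_adjP.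
  by apply: subset_trans (dL k) _; apply: ideal_adj_sub.
have [|||K2 K2P] := IH _ (ideal_colonP a iI) IaC (minS _ IaC)
    (fun k => ideal_colon (L k) a).
- by move=> k; apply: ideal_colonP.
- by move=> k x; apply: IL.
- by move=> k x; apply: dL.
exists (maxn K1 K2) => k; rewrite geq_max => /andP[K1k K2k] z Lz.
have [|s rs [l [c [Ll szE]]]] := K1P k K1k z; first exact: ideal_adj_sub.
(* In [s * z = l + c * a] the term [c * a] is in [L k], so [c] lies in the colon ideal and a factor
   [t] moves [c * a] into [L k.+1]. *)
have [|t rt Ltc] := K2P k K2k c.
  rewrite /ideal_colon /=; have -> : c * a = s * z - l by rewrite szE; ring.
  by apply: in_idealB; [|apply: in_idealMl|apply: dL].
exists (t * s); first exact: prime_mul.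
have -> : t * s * z = t * l + t * c * a by rewrite -mulrA szE; ring.
by apply: in_idealD => //; apply: in_idealMl.
Qed.

(** Nakayama for [M/N] localised at [r], by induction on generators of [M] over [N]: the relation
    between [sg * g] and [x * (h + b * g)] gives [g] the coefficient [sg - x * b], which is outside
    [r] and hence locally invertible, so [g] is redundant. *)
Lemma local_nakayama r (N M : set A) x :
  prime_ideal r -> is_ideal N -> is_ideal M -> N `<=` M -> r x ->
  (forall z, M z -> exists s c, [/\ ~ r s, M c & N (s * z - x * c)]) ->
  forall z, M z -> exists2 u, ~ r u & N (u * z).
Proof.
move=> pr iN iM NM rx Mx; have [ir r1 _] := pr.
have [gs [Mgs gsM]] := (iffLR (noetherianP A) noethA) _ iM.
pose span := foldr (fun g I => ideal_adj I g) N.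
have ispan s : is_ideal (span s) by elim: s => //= g s; apply: ideal_adjP.
have Nspan s : N `<=` span s.
  by elim: s => //= g s IH; apply: subset_trans IH _; apply: ideal_adj_sub.
have {gsM Mgs} ME : M = span gs.
  apply/seteqP; split.
    apply: gsM => // x'; elim: (gs) => //= g s IH; rewrite inE.
    move=> /orP[/eqP ->|/IH]; first exact: ideal_adj_gen.
    exact: ideal_adj_sub.
  elim: (gs) Mgs => //= g s IH Mgs; apply: ideal_adj_min => //.
    by apply: IH => y ys; apply: Mgs; rewrite inE ys orbT.
  by apply: Mgs; rewrite mem_head.
rewrite {}ME in Mx *; elim: gs Mx => [_ z Nz|g s IH Mx z /= Mz].
  by exists 1; rewrite ?mul1r.
have [sg [_ [rsg [h [b [sh ->]]] Ng]]] := Mx g (ideal_adj_gen _ (ispan s)).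
have rv : ~ r (sg - x * b).
  move=> rv; apply: rsg; apply: (in_idealDKr ir _ rv).
  by apply: in_idealN => //; apply: in_idealMr.
have vg : span s ((sg - x * b) * g).
  have -> : (sg - x * b) * g = (sg * g - x * (h + b * g)) + x * h by ring.
  by apply: in_idealD => //; [apply: Nspan|apply: in_idealMl].
have {}IH : forall z, span s z -> exists2 u, ~ r u & N (u * z).
  apply: IH => y sy; have [|t [_ [rt [h' [b' [sh' ->]]] Ny]]] := Mx y.
    exact: ideal_adj_sub.
  (* Multiplying by the local unit [sg - x * b] brings [b' * g] into [span s], so that the
     hypothesis on [M] passes to [span s]. *)
  exists ((sg - x * b) * t), ((sg - x * b) * h' + b' * ((sg - x * b) * g)).
  split; first exact: prime_mul.
    by apply: in_idealD => //; apply: in_idealMl.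
  have -> : (sg - x * b) * t * y -
      x * ((sg - x * b) * h' + b' * ((sg - x * b) * g)) =
    (sg - x * b) * (t * y - x * (h' + b' * g)) by ring.
  exact: in_idealMl.
case: Mz => [w [d [sw ->]]].
have [|u ru Nu] := IH ((sg - x * b) * (w + d * g)).
  have -> : (sg - x * b) * (w + d * g) =
    (sg - x * b) * w + d * ((sg - x * b) * g) by ring.
  by apply: in_idealD => //; apply: in_idealMl.
by exists (u * (sg - x * b)); [exact: prime_mul|rewrite -mulrA].
Qed.

(* Krull's principal ideal theorem in A/p.  The ideals [L k] are the
   saturations of [p + (y ^ k)] with respect to [x], which play the role of
   symbolic powers; modulo [x] they become locally stationary, and then so
   do they themselves, by Nakayama. *)
Lemma principal_ideal_theorem p r x y :
  prime_ideal p -> prime_ideal r -> p `<=` r -> r x -> ~ p y ->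
  min_prime_over r (ideal_adj p x) ->
  exists u m c, ~ r u /\ p (u * x ^+ m - c * y).
Proof.
move=> pp pr pr_sub rx py minr; have [ip p1 pM] := pp.
pose L k : set A := [set a | exists m c, p (x ^+ m * a - c * y ^+ k)].
have iL k : is_ideal (L k).
  split.
  - by exists 0%N, 0; rewrite mulr0 mul0r subrr; apply: in_ideal0.
  - move=> a b [m [c pa]] [n [d pb]]; exists (m + n)%N, (x ^+ n * c + x ^+ m * d).
    have -> : x ^+ (m + n) * (a + b) - (x ^+ n * c + x ^+ m * d) * y ^+ k =
      x ^+ n * (x ^+ m * a - c * y ^+ k) + x ^+ m * (x ^+ n * b - d * y ^+ k).
      by rewrite exprD; ring.
    by apply: in_idealD => //; apply: in_idealMl.
  - move=> a b [m [c pb]]; exists m, (a * c).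
    have -> : x ^+ m * (a * b) - a * c * y ^+ k = a * (x ^+ m * b - c * y ^+ k).
      by ring.
    exact: in_idealMl.
have pL k : p `<=` L k.
  by move=> a pa; exists 0%N, 0; rewrite mul0r subr0; apply: in_idealMl.
have dL k : L k.+1 `<=` L k.
  by move=> a [m [c pa]]; exists m, (c * y); rewrite -mulrA -exprS.
have Lcolon k a : L k (x * a) -> L k a.
  by move=> [m [c pa]]; exists m.+1, c; rewrite exprSr -mulrA.
have [|||K KP] := @local_dcc r _ pr (ideal_adjP x ip) minr
    (fun k => ideal_adj (L k) x).
- by move=> k; apply: ideal_adjP.
- move=> k; apply: ideal_adj_min (ideal_adj_gen _ _) => //.
    exact: ideal_adjP.
  by apply: subset_trans (pL k) _; apply: ideal_adj_sub.
- move=> k; apply: ideal_adj_min (ideal_adj_gen _ _) => //.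
    exact: ideal_adjP.
  by apply: subset_trans (dL k) _; apply: ideal_adj_sub.
have [||u ru [m [c pu]]] := @local_nakayama r (L K.+1) (L K) x pr (iL _) (iL _)
    (dL _) rx _ (y ^+ K).
- move=> z Lz; have [|s rs [b [c [Lb szE]]]] := KP K (leqnn _) z.
    exact: ideal_adj_sub.
  have sxE : s * z - x * c = b by rewrite szE; ring.
  (* Since [x * c] is in [L K], which is saturated with respect to [x], so is [c]: locally
     [L K = L K.+1 + x * L K], as Nakayama requires. *)
  exists s, c; split; rewrite ?sxE //; apply: Lcolon.
  have -> : x * c = s * z - b by rewrite szE; ring.
  by apply: in_idealB => //; [apply: in_idealMl|apply: dL].
- by exists 0%N, 1; rewrite subrr; apply: in_ideal0.
exists u, m, c; split=> //.
have : p (y ^+ K * (u * x ^+ m - c * y)).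
  have -> : y ^+ K * (u * x ^+ m - c * y) =
    x ^+ m * (u * y ^+ K) - c * y ^+ K.+1 by rewrite exprS; ring.
  by [].
by move=> /pM[] // /(prime_exp pp py).
Qed.

(** A minimal member of the finite list of [finite_primes_above] is minimal among all primes over
    [I], since each of those contains a member. *)
Lemma min_prime_above r I : is_ideal I -> prime_ideal r -> I `<=` r ->
  exists q, [/\ prime_ideal q, I `<=` q, q `<=` r & min_prime_over q I].
Proof.
move=> iI pr Ir; have [s [sI sP]] := finite_primes_above noethA iI.
have minseq (t : seq (set A)) M : M \in t ->
    exists q, [/\ q \in t, q `<=` M & forall Q, Q \in t -> Q `<=` q -> Q = q].
  elim: t M => // N t IH M; rewrite inE => MNt.
  have [[Q [Qt QN]]|noQ] := pselect (exists Q, Q \in t /\ Q `<=` N).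
    have [Q' [Q't Q'M]] : exists Q', Q' \in t /\ Q' `<=` M.
      by case/orP: MNt => [/eqP ->|Mt]; [exists Q|exists M; split=> // x].
    have [q [qt qQ minq]] := IH Q' Q't.
    exists q; split; [by rewrite inE qt orbT|exact: subset_trans Q'M|].
    move=> P; rewrite inE => /orP[/eqP -> Nq|]; last exact: minq.
    have Qq : Q = q by apply: minq => //; apply: subset_trans Nq.
    by apply/seteqP; split=> //; rewrite -Qq.
  case/orP: MNt => [/eqP ->|Mt].
    exists N; split; [exact: mem_head|by move=> x|].
    move=> P; rewrite inE => /orP[/eqP ->|Pt PN] //.
    by case: noQ; exists P.
  have [q [qt qM minq]] := IH M Mt.
  have [Nq|nNq] := pselect (N `<=` q).
    exists N; split; [exact: mem_head|exact: subset_trans qM|].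
    move=> P; rewrite inE => /orP[/eqP ->|Pt PN] //.
    by case: noQ; exists P.
  exists q; split; [by rewrite inE qt orbT|by []|].
  by move=> P; rewrite inE => /orP[/eqP ->|] //; apply: minq.
have [M Ms Mr] := sP r pr Ir; have [q [qs qM minq]] := minseq s M Ms.
have [pq Iq] := sI q qs; exists q; split=> //; first exact: subset_trans Mr.
move=> Q pQ IQ Qq; have [N Ns NQ] := sP Q pQ IQ.
have Nq : N = q by apply: minq => //; apply: subset_trans Qq.
by apply/seteqP; split=> //; rewrite -Nq.
Qed.

(** Induction on the number of primes. A prime of [s] contained in [P] may be dropped. Otherwise, a
    [y] that avoids [s] but falls into [P] is corrected by an element [z] of [r] lying in all of [s]
    but not in [P]. *)
Lemma prime_avoidance r (s : seq (set A)) : is_ideal r ->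
  (forall Q, Q \in s -> prime_ideal Q /\ ~ r `<=` Q) ->
  exists2 y, r y & forall Q, Q \in s -> ~ Q y.
Proof.
move=> ir; have [n] := ubnP (size s); elim: n s => // n IH [|P s] sn sP.
  by exists 0 => //; apply: in_ideal0.
have [pP nrP] := sP P (mem_head _ _).
have sP' Q : Q \in s -> prime_ideal Q /\ ~ r `<=` Q.
  by move=> Qs; apply: sP; rewrite inE Qs orbT.
have [[Q Qs QP]|/forall2NP noQ] := pselect (exists2 Q, Q \in s & Q `<=` P).
  have [||y ry ys] := IH (P :: rem Q s).
  - by rewrite /= size_rem // prednK; case: (s) Qs sn.
  - by move=> Q'; rewrite inE => /orP[/eqP -> //|/mem_rem/sP'].
  exists y => // Q'; rewrite inE => Q'Ps.
  have [->|nQ] := pselect (Q' = Q).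
    by move=> /QP; apply: ys; rewrite mem_head.
  apply: ys; rewrite inE; case/orP: Q'Ps => [-> //|Q's].
  have := perm_mem (perm_to_rem Qs) Q'; rewrite Q's inE => /esym.
  by move=> /orP[/eqP //|->]; rewrite orbT.
have [|y ry ys] := IH s _ sP'; first by [].
have [Py|Py] := pselect (P y); last first.
  by exists y => // Q; rewrite inE => /orP[/eqP ->|/ys].
have [z [rz Pz sz]] : exists z, [/\ r z, ~ P z & forall Q, Q \in s -> Q z].
  elim: (s) sP' noQ {ys sn sP} => [|Q t IHt] tP noQ.
    have /existsNP[z /not_implyP[rz Pz]] := nrP.
    by exists z; split.
  have [||z [rz Pz tz]] := IHt.
  - by move=> Q' Q't; apply: tP; rewrite inE Q't orbT.
  - move=> Q'; have [|] := noQ Q'; last by right.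
    by move=> nQ'; left=> Q't; apply: nQ'; rewrite inE Q't orbT.
  have [|] := noQ Q; first by rewrite mem_head.
  move=> /existsNP[w /not_implyP[Qw Pw]]; exists (w * z); split.
  - exact: in_idealMl.
  - exact: prime_mul.
  move=> Q'; rewrite inE => /orP[/eqP ->|Q't].
    by have [/prime_is_ideal iQ _] := tP Q (mem_head _ _); apply: in_idealMr.
  have [|/prime_is_ideal iQ _] := tP Q'; first by rewrite inE Q't orbT.
  by apply: in_idealMl => //; apply: tz.
exists (y + z) => [|Q]; first exact: in_idealD.
rewrite inE => /orP[/eqP -> Pyz|Qs Qyz].
  by apply: Pz; apply: (in_idealDKl (prime_is_ideal pP) Py).
have [/prime_is_ideal iQ _] := sP' Q Qs.
by apply: (ys _ Qs); apply: (in_idealDKr iQ (sz _ Qs)).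
Qed.

(* [y] is chosen in [r] outside the finitely many minimal primes over
   [p + (f)] lying strictly inside [r].  A prime [q'] minimal over [p + (y)]
   has height one over [p], so it could only contain [f] by being one of
   them. *)
Lemma prime_between_avoiding p q r f :
  prime_ideal p -> prime_ideal q -> prime_ideal r -> p `<` q -> q `<` r ->
  ~ p f -> exists q', [/\ prime_ideal q', p `<` q', q' `<` r & ~ q' f].
Proof.
move=> pp pq pr [pq_sub nqp] [qr nrq] pf.
have [ip _ _] := pp; have [ir _ _] := pr; have [iq _ _] := pq.
have [qf|qf] := pselect (q f); last by exists q.
have [s [sI sP]] := finite_primes_above noethA (ideal_adjP f ip).
pose t := [seq Q <- s | `[< ~ r `<=` Q >]].
have tP Q : Q \in t -> prime_ideal Q /\ ~ r `<=` Q.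
  by rewrite mem_filter => /andP[/asboolP nrQ /sI[pQ _]].
have [y ry ty] := prime_avoidance ir tP.
have below P : prime_ideal P -> p `<=` P -> P f -> P `<` r ->
    exists Q, [/\ prime_ideal Q, p `<=` Q, Q f, ~ Q y & Q `<=` P].
  move=> pP pP_sub Pf [Pr nrP].
  have [|Q Qs QP] := sP P pP.
    by apply: ideal_adj_min => //; apply: prime_is_ideal.
  have [pQ pfQ] := sI Q Qs; exists Q; split=> //.
  - by apply: subset_trans pfQ; apply: ideal_adj_sub.
  - by apply: pfQ; apply: ideal_adj_gen.
  - apply: ty; rewrite mem_filter Qs andbT; apply/asboolP => rQ.
    by apply: nrP; apply: subset_trans QP.
have [Q0 [_ pQ0 _ Q0y _]] := below q pq pq_sub qf (conj qr nrq).
have py : ~ p y by move=> /pQ0.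
have [|q' [pq' pyq' q'r minq']] := @min_prime_above r _ (ideal_adjP y ip) pr.
  by apply: ideal_adj_min => //; apply: subset_trans qr.
have q'y : q' y by apply: pyq'; apply: ideal_adj_gen.
have pq'_sub : p `<=` q' by apply: subset_trans pyq'; apply: ideal_adj_sub.
(* For [w] in [Q] outside [p], the principal ideal theorem would put [u * y ^+ m] in [p + (w)],
   hence in [Q]; but [u] is outside [q'], and [Q] misses [y] by minimality of [q']. *)
have height_one Q : prime_ideal Q -> p `<=` Q -> Q `<` q' -> Q `<=` p.
  move=> pQ pQ_sub [Qq' nq'Q] w Qw; apply: contrapT => pw.
  have [u [m [c [q'u pu]]]] :=
    principal_ideal_theorem pp pq' pq'_sub q'y pw minq'.
  have [iQ _ QM] := pQ.
  have Qy : ~ Q y.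
    move=> Qy; apply: nq'Q; rewrite -(minq' Q pQ _ Qq') //.
    exact: ideal_adj_min.
  have : Q (u * y ^+ m).
    rewrite -(subrK (c * w) (u * _)); apply: in_idealD => //; first exact: pQ_sub.
    exact: in_idealMl.
  by move=> /QM[/Qq'|/(prime_exp pQ Qy)].
(* Otherwise [q] would be a prime strictly between [p] and [q']. *)
have q'r_strict : q' `<` r.
  split=> // rq'; apply: nqp; apply: height_one => //; split.
    exact: subset_trans rq'.
  by move=> q'q; apply: nrq; apply: subset_trans q'q.
exists q'; split=> //; first by split=> // q'p; apply/py/q'p.
move=> q'f; have [Q [pQ pQ_sub Qf Qy Qq']] := below q' pq' pq'_sub q'f q'r_strict.
apply: pf; apply: (height_one Q) => //; split=> // q'Q.
by apply: Qy; apply: q'Q.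
Qed.

End PrincipalIdeal.

(** * Prime chains and the Jacobson property *)

Definition prime_chain (A : comPzRingType) (n : nat) (P : nat -> set A) : Prop :=
  (forall i, (i <= n)%N -> prime_ideal (P i)) /\
  (forall i, (i < n)%N -> P i `<` P i.+1).

Lemma jacobsonP (A : comPzRingType) :
  jacobson A <-> forall (P : set A) f, prime_ideal P -> ~ P f ->
    exists M : set A, [/\ maximal_ideal M, P `<=` M & ~ M f].
Proof.
split=> [jacA P f pP Pf|h P pP].
  have [F Fmax PE] := jacA P pP; apply: contrapT => noM; apply: Pf.
  rewrite PE => M FM; apply: contrapT => Mf; apply: noM; exists M; split=> //.
    exact: Fmax.
  by rewrite PE; apply: bigcap_inf.
exists [set M | maximal_ideal M /\ P `<=` M]; first by move=> M [].
apply/seteqP; split=> [x Px M [_]|x Mx]; first exact.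
apply: contrapT => Px; have [M [mM PM]] := h P x pP Px.
by apply; apply: Mx.
Qed.

(** Induction from the bottom: a prime between [P 0] and [P 2] avoiding [f] replaces [P 1] and
    starts the remaining chain. In length one there is no [P 2], and the Jacobson property gives a
    maximal ideal instead. The bottom is kept because lifting starts there. *)
Lemma prime_chain_avoiding (A : comNzRingType) n (P : nat -> set A) f :
  noetherian A -> jacobson A -> prime_chain n P -> ~ P 0%N f ->
  exists P' : nat -> set A, [/\ prime_chain n P', P' 0%N = P 0%N & ~ P' n f].
Proof.
move=> noethA /jacobsonP jacA.
elim: n P => [|[|n] IH] P [pP sP] P0f; first by exists P.
  have [M [mM PM Mf]] := jacA _ _ (pP 0%N isT) P0f.
  exists (fun i => if i is 0 then P 0%N else M); split=> //; split.
    by move=> [|[|//]] _; [apply: pP|apply: maximal_prime].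
  case=> // _; split=> // MP; have [P01 nP10] := sP 0%N isT.
  have [iP1 P11 _] := pP 1%N isT; have [_ _ maxM] := mM.
  by apply: nP10; rewrite (maxM (P 1%N)) //; apply: subset_trans P01.
have [q [pq P0q qP2 qf]] := prime_between_avoiding noethA
  (pP 0%N isT) (pP 1%N isT) (pP 2 isT) (sP 0%N isT) (sP 1%N isT) P0f.
have [||P' [[pP' sP'] P'0 P'f]] := IH (fun i => if i is 0 then q else P i.+1).
- by split=> [[|i] // i_n|[|i] // i_n]; [apply: pP|apply: sP].
- by [].
exists (fun i => if i is i'.+1 then P' i' else P 0%N); split=> //; split.
  by case=> [_|i i_n]; [apply: pP|apply: pP'].
by case=> [_|i i_n]; [rewrite P'0|apply: sP'].
Qed.

(** * Polynomial extensions *)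

Lemma preimage_ideal (A B : comPzRingType) (phi : {rmorphism A -> B}) (J : set B) :
  is_ideal J -> is_ideal (phi @^-1` J).
Proof.
case=> J0 JD JM; split=> [|x y Jx Jy|a x Jx]; rewrite /preimage /=.
- by rewrite rmorph0.
- by rewrite rmorphD; apply: JD.
- by rewrite rmorphM; apply: JM.
Qed.

Lemma preimage_prime (A B : comPzRingType) (phi : {rmorphism A -> B}) (Q : set B) :
  prime_ideal Q -> prime_ideal (phi @^-1` Q).
Proof.
case=> iQ Q1 QM; split; first exact: preimage_ideal.
  by rewrite /preimage /= rmorph1.
by move=> x y; rewrite /preimage /= rmorphM; apply: QM.
Qed.

(** Going up away from [f], which depends on [Q] and [g] but not on the chain. Keeping [g] out of
    the top prime makes the property compose: the [f] obtained for one map serves as the [g] of the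
    map before it. *)
Definition lifts_chains (A B : comPzRingType) (phi : A -> B) : Prop :=
  forall (Q : set B) g, prime_ideal Q -> ~ Q g ->
  exists f, ~ Q (phi f) /\ forall n (P : nat -> set A),
    prime_chain n P -> P 0%N = phi @^-1` Q -> ~ P n f ->
    exists Qs : nat -> set B, [/\ prime_chain n Qs, Qs 0%N = Q,
      forall i, (i <= n)%N -> phi @^-1` (Qs i) = P i & ~ Qs n g].

Section PolynomialExtension.
Variable A : comNzRingType.
Implicit Types (p m : set A) (Q I W : set {poly A}) (F G H K : {poly A}).

Definition poly_ideal p : set {poly A} := [set F | forall i, p F`_i].

Lemma poly_idealP p : is_ideal p -> is_ideal (poly_ideal p).
Proof.
move=> ip; split=> [i|F G pF pG i|F G pG i].
- by rewrite coef0; apply: in_ideal0.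
- by rewrite coefD; apply: in_idealD.
- rewrite coefM; apply: in_ideal_sum => // j _; exact: in_idealMl.
Qed.

(** If the first coefficients of [F] and [G] outside [p] are in degrees [i] and [j], then modulo [p]
    their product is the coefficient of [F * G] in degree [i + j]. *)
Lemma poly_ideal_prime p : prime_ideal p -> prime_ideal (poly_ideal p).
Proof.
move=> pp; have [ip p1 pM] := pp; split; first exact: poly_idealP.
  by move=> /(_ 0%N); rewrite coef1.
move=> F G pFG; apply: contrapT => /not_orP[/existsNP nF /existsNP nG].
have [i Fi Fmin] := least_nat nF; have [j Gj Gmin] := least_nat nG.
apply: (prime_mul pp Fi Gj); have := pFG (i + j)%N.
have ij : (i < (i + j).+1)%N by rewrite ltnS leq_addr.
rewrite coefM (bigD1 (Ordinal ij)) //= addKn; apply: in_idealDKr => //.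
apply: in_ideal_sum => // k kNi; have [ki|ik] := ltnP k i.
  by apply: in_idealMr => //; apply: contrapT; apply: Fmin.
apply: in_idealMl => //; apply: contrapT; apply: Gmin.
have : k != i :> nat by rewrite -val_eqE in kNi.
by have := ltn_ord k; lia.
Qed.

Lemma preimage_poly_ideal p : is_ideal p -> polyC @^-1` (poly_ideal p) = p.
Proof.
move=> ip; apply/seteqP; split=> a; rewrite /preimage /=.
  by move=> /(_ 0%N); rewrite coefC.
by move=> pa i; rewrite coefC; case: eqP => // _; apply: in_ideal0.
Qed.

Lemma poly_ideal_min p Q :
  is_ideal Q -> (forall a, p a -> Q a%:P) -> poly_ideal p `<=` Q.
Proof.
move=> iQ pQ F pF; rewrite -(coefK F) poly_def; apply: in_ideal_sum => // i _.
by rewrite -mul_polyC; apply: in_idealMr => //; apply: pQ.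
Qed.

Lemma truncate_mod p F : is_ideal p -> ~ poly_ideal p F ->
  exists n G, [/\ (n < size F)%N, ~ p G`_n, (size G <= n.+1)%N
    & poly_ideal p (F - G)].
Proof.
move=> ip /existsNP[i Fi].
have ex : exists n, `[< ~ p F`_n >] by exists i; apply/asboolP.
have bound n : `[< ~ p F`_n >] -> (n <= size F)%N.
  move=> /asboolP Fn; rewrite leqNgt; apply/negP => nF; apply: Fn.
  by rewrite nth_default ?(ltnW nF) //; apply: in_ideal0.
case: (ex_maxnP ex bound) => n /asboolP Fn nmax.
exists n, (\poly_(j < n.+1) F`_j); split.
- rewrite ltnNge; apply/negP => nF; apply: Fn.
  by rewrite nth_default //; apply: in_ideal0.
- by rewrite coef_poly ltnSn.
- exact: size_poly.
- move=> j; rewrite coefB coef_poly; case: ltnP => [_|nj].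
    by rewrite subrr; apply: in_ideal0.
  rewrite subr0; apply: contrapT => Fj.
  by have := nmax j (introT (asboolP _) Fj); rewrite leqNgt nj.
Qed.

(** Each step multiplies by the coefficient of [H] in degree [n], which need not be a unit, and
    cancels the top term. *)
Lemma pseudo_division H n F : (size H <= n.+1)%N ->
  exists k (K R : {poly A}),
  [/\ (H`_n)%:P ^+ k * F = K * H + R, (size R <= n)%N
    & (size K <= size F - n)%N].
Proof.
move=> sH; have [m] := ubnP (size F); elim: m F => // m IH F Fm.
have [Fn|nF] := leqP (size F) n.
  by exists 0%N, 0, F; rewrite expr0 mul1r mul0r add0r size_poly0.
set e := ((size F).-1 - n)%N.
have FE : size F = (n + e).+1 by rewrite /e; lia.
pose F1 := (H`_n)%:P * F - (F`_(n + e))%:P * 'X^e * H.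
have sF1 : (size F1 <= n + e)%N.
  apply/leq_sizeP => j nej.
  rewrite coefB -mulrA !coefCM coefXnM ltnNge (leq_trans (leq_addl n e) nej) /=.
  have [->|jne] := eqVneq j (n + e)%N; first by rewrite addnK mulrC subrr.
  have nej' : (n + e < j)%N by rewrite ltn_neqAle eq_sym jne.
  rewrite [F`_j]nth_default ?FE // [H`_(j - e)]nth_default ?mulr0 ?subrr //.
  by apply: leq_trans sH _; lia.
have [|k [K [R [kE sR sK]]]] := IH F1; first by lia.
exists k.+1, (K + (H`_n)%:P ^+ k * (F`_(n + e))%:P * 'X^e), R; split=> //.
  have -> : (H`_n)%:P ^+ k.+1 * F = (H`_n)%:P ^+ k * F1 +
    (H`_n)%:P ^+ k * (F`_(n + e))%:P * 'X^e * H by rewrite /F1 exprS; ring.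
  by rewrite kE; ring.
apply: leq_trans (size_polyD _ _) _; rewrite geq_max; apply/andP; split.
  by lia.
rewrite -rmorphXn -rmorphM /= mul_polyC; apply: leq_trans (size_scale_leq _ _) _.
by rewrite size_polyXn FE -addnS addKn.
Qed.

(** A nonzero polynomial of least degree in the image of [W] over [A/p]: truncation modulo [p] stays
    in [W] because [W] contains [p[X]]. *)
Lemma least_degree p W F : is_ideal p -> is_ideal W -> poly_ideal p `<=` W ->
  W F -> ~ poly_ideal p F ->
  exists n H, [/\ W H, ~ p H`_n, (size H <= n.+1)%N
    & forall R, W R -> (size R <= n)%N -> poly_ideal p R].
Proof.
move=> ip iW pW WF nF.
pose D n := exists H, [/\ W H, ~ p H`_n & (size H <= n.+1)%N].
have trunc R : W R -> ~ poly_ideal p R -> exists2 n, (n < size R)%N & D n.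
  move=> WR /(truncate_mod ip)[n [G [nR Gn sG pRG]]]; exists n => //; exists G.
  split=> //; rewrite -(subKr R G).
  by apply: in_idealB => //; apply: pW.
have [n0 _ Dn0] := trunc F WF nF.
have [n [H [WH Hn sH]] nmin] := least_nat (ex_intro _ n0 Dn0).
exists n, H; split=> // R WR sR; apply: contrapT => /(trunc R WR)[k kR].
by apply: nmin; apply: leq_trans kR sR.
Qed.

(* Modulo [Q] the variable is algebraic over [A/p], hence so is [g], and a
   nonzero element of an algebraic extension divides a nonzero constant. *)
Lemma algebraic_divides_constant Q F g :
  let p := polyC @^-1` Q in
  prime_ideal Q -> Q F -> ~ poly_ideal p F -> ~ Q g ->
  exists c, ~ p c /\ ideal_adj Q g c%:P.
Proof.
move=> p pQ QF nF Qg; have [iQ _ QM] := pQ.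
have pp : prime_ideal p := preimage_prime _ pQ.
have [ip _ _] := pp.
have pQ_sub : poly_ideal p `<=` Q by apply: poly_ideal_min.
have iW := ideal_adjP g iQ; have QW : Q `<=` ideal_adj Q g := @ideal_adj_sub _ Q g.
have [n [H [WH Hn sH Wmin]]] :=
  least_degree ip iW (subset_trans pQ_sub QW) (QW _ QF) nF.
have exp_notin k : ~ Q ((H`_n)%:P ^+ k) by rewrite -rmorphXn; apply: (prime_exp pp).
have [n0|n_gt0] := posnP n.
  by exists H`_0; rewrite n0 in Hn sH; split=> //; rewrite -size1_polyC.
(* The case [n > 0] is contradictory: dividing [E], of least degree in [Q], by [H] shows that [H] is
   in [Q], and dividing [g] by [H] then puts [g] in [Q]. *)
have [d [E [QE Ed sE Qmin]]] := least_degree ip iQ pQ_sub QF nF.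
have QH : Q H.
  have [k [K [R [kE sR sK]]]] := pseudo_division E sH.
  have pR : poly_ideal p R.
    apply: Wmin => //; rewrite -(addKr (K * H) R) -kE addrC.
    apply: in_idealB => //; last exact: in_idealMl.
    by apply: in_idealMl => //; apply: QW.
  have : Q (K * H).
    apply: (in_idealDKr iQ (pQ_sub _ pR)); rewrite -kE.
    exact: in_idealMl.
  move=> /QM[QK|//]; exfalso.
  have ipp := poly_idealP ip.
  have pK : poly_ideal p K by apply: Qmin => //; lia.
  have : poly_ideal p ((H`_n)%:P ^+ k * E).
    rewrite kE; exact: (in_idealD ipp (in_idealMr ipp H pK) pR).
  have [_ _ ppM] := poly_ideal_prime pp.
  by move=> /ppM[/pQ_sub/exp_notin //|/(_ d)].
have [k [K [R [kE sR sK]]]] := pseudo_division g sH.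
have WR : ideal_adj Q g R.
  rewrite -(addKr (K * H) R) -kE addrC.
  apply: in_idealB => //; last exact: in_idealMl.
  by apply: in_idealMl => //; apply: ideal_adj_gen.
have : Q ((H`_n)%:P ^+ k * g).
  rewrite kE; apply: in_idealD => //; first exact: in_idealMl.
  by apply: pQ_sub; apply: Wmin.
by move=> /QM[/exp_notin|].
Qed.

Lemma poly_split0 F :
  exists2 G, F = G * 'X + (F`_0)%:P & forall i, G`_i = F`_i.+1.
Proof.
pose G := \poly_(i < size F) F`_i.+1.
have GE i : G`_i = F`_i.+1.
  by rewrite coef_poly; case: ltnP => // Fi; rewrite nth_default // ltnW.
exists G => //; apply/polyP => i; rewrite coefD coefMX coefC.
by case: i => [|i] /=; rewrite ?add0r ?addr0.
Qed.

Hypothesis noethA : noetherian A.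

(* Hilbert's basis theorem: [L d] is the ideal of the coefficients of degree
   [d] of the elements of [I] of degree at most [d]. *)
Lemma noetherian_poly : noetherian {poly A}.
Proof.
apply/noetherianP => I iI.
pose L d : set A := [set c | exists F, [/\ I F, (size F <= d.+1)%N & F`_d = c]].
have iL d : is_ideal (L d).
  split.
  - by exists 0; rewrite size_poly0 coef0; split=> //; apply: in_ideal0.
  - move=> _ _ [F [IF sF <-]] [G [IG sG <-]]; exists (F + G); split.
    + exact: in_idealD.
    + by apply: leq_trans (size_polyD _ _) _; rewrite geq_max sF.
    + by rewrite coefD.
  - move=> a _ [F [IF sF <-]]; exists (a%:P * F); split; rewrite ?coefCM //.
    + exact: in_idealMl.
    + by rewrite mul_polyC; apply: leq_trans (size_scale_leq _ _) sF.
have LS d : L d `<=` L d.+1.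
  move=> _ [F [IF sF <-]]; exists (F * 'X); split.
  - exact: in_idealMr.
  - apply/leq_sizeP => j dj; rewrite coefMX; case: j dj => // j dj /=.
    by rewrite nth_default //; apply: leq_trans sF _.
  - by rewrite coefMX.
have Lmono d e : (d <= e)%N -> L d `<=` L e.
  move=> /subnKC <-; elim: (e - d)%N => [|k IH]; first by rewrite addn0.
  by rewrite addnS; apply: subset_trans IH (LS _).
have [||_ [[d _ <-] _ Lmax]] := noetherian_max noethA (F := range L) (I := L 0%N).
- by move=> _ [d _ <-].
- by exists 0%N.
have fin e : exists s : seq {poly A}, (forall F, F \in s -> I F) /\
    forall J, is_ideal J -> (forall F, F \in s -> J F) ->
    forall F, I F -> (size F <= e)%N -> J F.
  elim: e => [|e [s [sI sP]]].
    exists [::]; split=> // J iJ _ F _; rewrite leqn0 size_poly_eq0 => /eqP ->.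
    exact: in_ideal0.
  have [t [tL tP]] := (iffLR (noetherianP A) noethA) _ (iL e).
  have [u [uI uP]] : exists u : seq {poly A}, (forall F, F \in u -> I F) /\
      forall c, c \in t -> exists F, [/\ F \in u, (size F <= e.+1)%N & F`_e = c].
    elim: (t) tL => [|c t' IH] tL; first by exists [::].
    have [|u [uI uP]] := IH.
      by move=> x xt; apply: tL; rewrite inE xt orbT.
    have [F [IF sF Fe]] := tL c (mem_head _ _).
    exists (F :: u); split=> [G|x].
      by rewrite inE => /orP[/eqP ->|/uI].
    rewrite inE => /orP[/eqP ->|/uP[G [Gu sG Ge]]].
      by exists F; rewrite mem_head.
    by exists G; rewrite inE Gu orbT.
  exists (s ++ u); split=> [F|J iJ suJ F IF sF].
    by rewrite mem_cat => /orP[/sI|/uI].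
  pose LJ : set A :=
    [set c | exists G, [/\ I G, J G, (size G <= e.+1)%N & G`_e = c]].
  have sLJ : L e `<=` LJ.
    apply: tP.
      split.
      - by exists 0; rewrite size_poly0 coef0; split=> //; apply: in_ideal0.
      - move=> _ _ [G [IG JG sG <-]] [G' [IG' JG' sG' <-]]; exists (G + G').
        split; [exact: in_idealD|exact: in_idealD| |by rewrite coefD].
        by apply: leq_trans (size_polyD _ _) _; rewrite geq_max sG.
      - move=> a _ [G [IG JG sG <-]]; exists (a%:P * G).
        split; [exact: in_idealMl|exact: in_idealMl| |by rewrite coefCM].
        by rewrite mul_polyC; apply: leq_trans (size_scale_leq _ _) sG.
    move=> c /uP[G [Gu sG Ge]]; exists G; split=> //; first exact: uI.
    by apply: suJ; rewrite mem_cat Gu orbT.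
  have [|G [IG JG sG Ge]] := sLJ F`_e; first by exists F.
  rewrite -(subrK G F); apply: in_idealD => //.
  apply: (sP J iJ) => [H Hs||].
  - by apply: suJ; rewrite mem_cat Hs.
  - exact: in_idealB.
  apply/leq_sizeP => j ej; rewrite coefB; have [<-|jne] := eqVneq e j.
    by rewrite Ge subrr.
  have ej' : (e < j)%N by rewrite ltn_neqAle jne.
  by rewrite !nth_default ?subrr //; apply: leq_trans ej'.
have [s [sI sP]] := fin d.+1; exists s; split=> // J iJ sJ F IF.
have [k] := ubnP (size F); elim: k F IF => // k IH F IF Fk.
have [Fd|dF] := leqP (size F) d.+1; first exact: sP.
set e := (size F).-1; have Fe : size F = e.+1 by rewrite /e; lia.
(* Beyond degree [d] the ideals [L] are constant, so a shift of some [G] in [I] of degree at most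
   [d] cancels the leading term of [F]. *)
have : L d F`_e.
  rewrite -(Lmax (L e)); first by exists F; rewrite Fe.
    by exists e.
  by apply: Lmono; lia.
move=> [G [IG sG Gd]].
rewrite -(subrK ('X^(e - d) * G) F); apply: in_idealD => //; last first.
  by apply: in_idealMl => //; apply: sP.
apply: IH; first by apply: in_idealB => //; apply: in_idealMl.
suff sFG : (size (F - 'X^(e - d) * G)%R <= e)%N.
  by rewrite Fe ltnS in Fk; apply: leq_ltn_trans sFG Fk.
apply/leq_sizeP => j ej; rewrite coefB coefXnM.
have -> : (j < e - d)%N = false by lia.
have [<-|jne] := eqVneq e j.
  by rewrite subKn ?Gd ?subrr //; rewrite Fe in dF; lia.
rewrite !nth_default ?subrr //; last by rewrite Fe ltn_neqAle jne.
by apply: leq_trans sG _; rewrite Fe in dF; lia.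
Qed.

End PolynomialExtension.

(** * Going up and the Jacobson property for polynomial rings *)

Definition ideal_plus (A : comNzRingType) (I J : set A) : set A :=
  [set z | exists x y, [/\ I x, J y & z = x + y]].

Lemma ideal_plusP (A : comNzRingType) (I J : set A) :
  is_ideal I -> is_ideal J -> is_ideal (ideal_plus I J).
Proof.
move=> iI iJ; split.
- by exists 0, 0; split; rewrite ?addr0 //; apply: in_ideal0.
- move=> _ _ [x [y [Ix Jy ->]]] [x' [y' [Ix' Jy' ->]]].
  by exists (x + x'), (y + y'); split; [exact: in_idealD|exact: in_idealD|ring].
- move=> a _ [x [y [Ix Jy ->]]]; exists (a * x), (a * y).
  by split; [exact: in_idealMl|exact: in_idealMl|ring].
Qed.

Lemma ideal_plus_subl (A : comNzRingType) (I J : set A) :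
  is_ideal J -> I `<=` ideal_plus I J.
Proof.
by move=> iJ x Ix; exists x, 0; split; rewrite ?addr0 //; apply: in_ideal0.
Qed.

Lemma ideal_plus_subr (A : comNzRingType) (I J : set A) :
  is_ideal I -> J `<=` ideal_plus I J.
Proof.
by move=> iI x Ix; exists 0, x; split; rewrite ?add0r //; apply: in_ideal0.
Qed.

Section PolynomialPrimes.
Variable A : comNzRingType.
Hypothesis noethA : noetherian A.
Implicit Types (p m : set A) (Q I W : set {poly A}) (F G H K : {poly A}).

(* If [s] lies in [Q + p[X]] then some [G] in [Q] is congruent to [s] modulo
   [p].  Let [F] in [Q] have least degree among the polynomials whose leading
   coefficient is not in [p]: reduce [G] modulo [F], and then cancel the
   constant coefficients of [F] and [G] against each other and divide by [X]
   to lower the degree of [F]. *)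
Lemma constant_in_ideal_plus Q p F n s :
  prime_ideal Q -> prime_ideal p -> (forall a, Q a%:P -> p a) ->
  Q F -> ~ p F`_n -> (size F <= n.+1)%N ->
  ideal_plus Q (poly_ideal p) s%:P -> p s.
Proof.
move=> pQ pp Qp; have [iQ _ QM] := pQ; have [ip _ _] := pp.
pose D n := exists F, [/\ Q F, ~ p F`_n & (size F <= n.+1)%N].
move=> QF nF sF; have [d [E [QE Ed sE]] dmin] :=
  least_nat (ex_intro D n (ex_intro _ F (And3 QF nF sF))).
move=> [q [h [Qq ph sqh]]]; apply: contrapT => ps.
case: d => [|d] in Ed sE dmin.
  by apply/Ed/Qp; rewrite -size1_polyC.
(* Modulo [p], a good polynomial is a nonzero constant. *)
pose good G := [/\ Q G, ~ p G`_0 & forall i, (0 < i)%N -> p G`_i].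
have {q h Qq ph sqh} [G0 goodG0] : exists G, good G.
  have qE : q = s%:P - h by rewrite sqh addrK.
  exists q; split=> // [|i i_gt0]; rewrite qE coefB coefC.
    by move=> /(in_idealDKr ip (in_idealN ip (ph 0%N))).
  by rewrite gtn_eqF // sub0r; apply: in_idealN.
have [G [QG G0p Gp] sG] : exists2 G, good G & (size G <= d.+1)%N.
  have [k] := ubnP (size G0); elim: k G0 goodG0 => // k IH G goodG Gk.
  have [sG|sG] := leqP (size G) d.+1; first by exists G.
  have [QG G0p Gp] := goodG.
  set e := ((size G).-1 - d.+1)%N.
  have Ge : size G = (d.+1 + e).+1 by rewrite /e; lia.
  rewrite Ge ltnS in Gk.
  apply: (IH ((E`_d.+1)%:P * G - (G`_(d.+1 + e))%:P * 'X^e * E)).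
    have pG j : p (G`_(d.+1 + e) * ('X^e * E)`_j).
      by apply: in_idealMr => //; apply: Gp.
    split=> [||i i_gt0].
    - by apply: in_idealB => //; apply: in_idealMl.
    - rewrite coefB -mulrA !coefCM.
      by move=> /(in_idealDKr ip (in_idealN ip (pG _))); apply: prime_mul.
    - rewrite coefB -mulrA !coefCM; apply: in_idealB => //.
      by apply: in_idealMl => //; apply: Gp.
  apply: leq_ltn_trans Gk; apply/leq_sizeP => j ej.
  rewrite coefB -mulrA !coefCM coefXnM ltnNge (leq_trans (leq_addl _ e) ej) /=.
  have [->|jne] := eqVneq j (d.+1 + e)%N; first by rewrite addnK mulrC subrr.
  rewrite [G`_j]nth_default; last by rewrite Ge ltn_neqAle eq_sym jne.
  rewrite [E`_(j - e)]nth_default ?mulr0 ?subrr //.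
  by apply: leq_trans sE _; lia.
have X_Q : ~ Q 'X.
  move=> QX; have [G' GE _] := poly_split0 G; apply/G0p/Qp.
  rewrite [G]GE in QG; apply: in_idealDKl QG => //.
  exact: in_idealMl.
pose N := (G`_0)%:P * E - (E`_0)%:P * G.
have QN : Q N by apply: in_idealB => //; apply: in_idealMl.
have [N' NE N'E] := poly_split0 N.
have N0 : N`_0 = 0 by rewrite coefB !coefCM mulrC subrr.
rewrite N0 addr0 in NE; rewrite NE in QN.
have {QN} QN' : Q N' by case/QM: QN.
(* As [size G <= d.+1], the coefficient of [N'] in degree [d] is the product of the constant
   coefficient of [G] and the leading one of [E], both outside [p]. *)
apply: (dmin d (ltnSn d)); exists N'; split=> //.
  rewrite N'E coefB !coefCM (nth_default _ sG) mulr0 subr0.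
  exact: prime_mul.
apply/leq_sizeP => j dj; rewrite N'E coefB !coefCM.
rewrite [G`_j.+1]nth_default ?[E`_j.+1]nth_default ?mulr0 ?subrr //.
  exact: leq_trans sE _.
by apply: leq_trans sG _; apply: leqW.
Qed.

(** The leading coefficient of [F] is invertible in the localisation at [p], over which the variable
    becomes integral modulo [Q]. The prime is found above [Q + p[X]], disjoint from the constants
    outside [p]; [constant_in_ideal_plus] makes this possible. *)
Lemma going_up_poly Q p F n :
  prime_ideal Q -> prime_ideal p -> (forall a, Q a%:P -> p a) ->
  Q F -> ~ p F`_n -> (size F <= n.+1)%N ->
  exists Q', [/\ prime_ideal Q', Q `<=` Q' & polyC @^-1` Q' = p].
Proof.
move=> pQ pp Qp QF nF sF; have [iQ _ _] := pQ; have [ip p1 _] := pp.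
have ipp := poly_idealP ip.
have [|||Q' [pQ' QQ' disj _]] := @prime_disjoint _ (noetherian_poly noethA)
    (ideal_plus Q (poly_ideal p)) [set a%:P | a in ~` p].
- exact: ideal_plusP.
- split; first by exists 1.
  move=> _ _ [a pa <-] [b pb <-]; exists (a * b); rewrite ?rmorphM //.
  exact: prime_mul.
- move=> x Qx [a pa ax]; apply: pa; rewrite -ax in Qx.
  exact: (constant_in_ideal_plus pQ pp Qp QF nF sF Qx).
exists Q'; split=> //; first by apply: subset_trans QQ'; apply: ideal_plus_subl.
apply/seteqP; split=> a.
  by move=> Q'a; apply: contrapT => pa; apply: (disj _ Q'a); exists a.
move=> pa; apply: QQ'; apply: ideal_plus_subr => // i.
by rewrite coefC; case: eqP => // _; apply: in_ideal0.
Qed.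

(** If [Q = p[X]], every prime of the chain is extended and [f] is a coefficient of [g]. Otherwise
    [f] has two factors: the leading coefficient of some [G] in [Q], whose avoidance allows going
    up, and a constant [c] in [Q + (g)], whose avoidance keeps [g] out of the top prime. *)
Lemma lifts_chains_polyC : lifts_chains (@polyC A).
Proof.
move=> Q g pQ Qg; set p := polyC @^-1` Q.
have pp : prime_ideal p := preimage_prime _ pQ.
have [iQ _ _] := pQ; have [ip _ _] := pp.
have pQ_sub : poly_ideal p `<=` Q by apply: poly_ideal_min.
have [Qp|/existsNP[F /not_implyP[QF nF]]] := pselect (Q `<=` poly_ideal p).
  have QE : poly_ideal p = Q by apply/seteqP.
  have /existsNP[i gi] : ~ poly_ideal p g by rewrite QE.
  exists g`_i; split=> [//|n P [pP sP] P0 Pn].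
  exists (fun i => poly_ideal (P i)); split; last by move=> /(_ i).
  - split=> [j j_n|j j_n]; first by apply: poly_ideal_prime; apply: pP.
    have [PS nPS] := sP j j_n; split; first by move=> F PF k; apply: PS.
    move=> S_P; apply: nPS; have [ij _ _] := pP j (ltnW j_n).
    have [iSj _ _] := pP _ j_n.
    by rewrite -(preimage_poly_ideal ij) -(preimage_poly_ideal iSj) => a /S_P.
  - by rewrite P0.
  - by move=> j /pP[ij _ _]; apply: preimage_poly_ideal.
have [c [pc [b [d [Qb cE]]]]] := algebraic_divides_constant pQ QF nF Qg.
have [k [G [_ Gk sG pFG]]] := truncate_mod ip nF.
have QG : Q G by rewrite -(subKr F G); exact: (in_idealB iQ QF (pQ_sub _ pFG)).
exists (c * G`_k); split; first exact: (prime_mul pp pc Gk).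
move=> n P cP P0 Pn.
suff [Qs [[pQs sQs] Qs0 QsP]] : exists Qs : nat -> set {poly A},
    [/\ prime_chain n Qs, Qs 0%N = Q
      & forall i, (i <= n)%N -> polyC @^-1` Qs i = P i].
  exists Qs; split=> // Qsg; apply: Pn; have [iPn _ _] := cP.1 n (leqnn n).
  have [iQn _ _] := pQs n (leqnn n).
  apply: in_idealMr => //; rewrite -QsP // /preimage /= cE; apply: in_idealD => //.
    suff mono i : (i <= n)%N -> Q `<=` Qs i by apply: (mono n).
    elim: i => [|i IH] i_n; first by rewrite Qs0.
    by apply: subset_trans (IH (ltnW i_n)) _; case: (sQs i i_n).
  exact: in_idealMl.
elim: n cP Pn => [|n IH] [pP sP] Pn.
  exists (fun=> Q); split=> [||i]; [by split|by []|].
  by rewrite leqn0 => /eqP ->; rewrite P0.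
have [PnS nPnS] := sP n (ltnSn n).
have [||Qs [[pQs sQs] Qs0 QsP]] := IH.
- by split=> i i_n; [apply: pP|apply: sP]; apply: leqW.
- by move=> /PnS.
have Qmono i : (i <= n)%N -> Q `<=` Qs i.
  elim: i => [|i IHi] i_n; first by rewrite Qs0.
  by apply: subset_trans (IHi (ltnW i_n)) _; case: (sQs i i_n).
have [|||||Q' [pQ' QQ' Q'P]] := @going_up_poly (Qs n) (P n.+1) G k _ (pP _ (leqnn _)).
- exact: pQs.
- by move=> a Qa; apply: PnS; rewrite -QsP.
- exact: Qmono.
- by move=> Gk'; apply: Pn; have [iS _ _] := pP _ (leqnn n.+1); apply: in_idealMl.
- by [].
exists (fun i => if (i <= n)%N then Qs i else Q'); split=> //; first split.
- by move=> i _; case: leqP => // /pQs.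
- move=> i; rewrite ltnS => i_n; rewrite i_n; case: ltnP => [/sQs //|ni].
  have -> : i = n by apply/eqP; rewrite eqn_leq i_n.
  split=> // Q'Q; apply: nPnS; rewrite -Q'P -(QsP n (leqnn n)) => a.
  exact: Q'Q.
- move=> i i_n; case: leqP => [/QsP //|ni].
  by have -> : i = n.+1 by apply/eqP; rewrite eqn_leq i_n.
Qed.

(* If [Q] is extended from [p], the maximal ideal is found above [1 + g X],
   which is not a unit modulo [m] when [g] is nonzero there.  Otherwise the
   extension is algebraic, and [g] divides a constant [c] modulo [Q] that the
   maximal ideal [m] of [A] avoids. *)
Lemma jacobson_poly : jacobson A -> jacobson {poly A}.
Proof.
move=> /jacobsonP jacA; apply/jacobsonP => Q g pQ Qg.
set p := polyC @^-1` Q.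
have pp : prime_ideal p := preimage_prime _ pQ.
have [iQ _ _] := pQ; have [ip _ _] := pp.
have pQ_sub : poly_ideal p `<=` Q by apply: poly_ideal_min.
have [Qp|/existsNP[F /not_implyP[QF nF]]] := pselect (Q `<=` poly_ideal p).
  have QE : poly_ideal p = Q by apply/seteqP.
  have /existsNP[i gi] : ~ poly_ideal p g by rewrite QE.
  have [m [mm pm mgi]] := jacA p _ pp gi.
  have [im m1 mM] := maximal_prime mm.
  have imX := poly_idealP im; have pmX := poly_ideal_prime (And3 im m1 mM).
  pose h := 1 + g * 'X.
  have nW1 : ~ ideal_adj (poly_ideal m) h 1.
    move=> [b [K [mb E1]]].
    have Kh : poly_ideal m (1 - K * h).
      by rewrite E1 addrK.
    have Kn : ~ poly_ideal m K.
      move=> mK; have := Kh 0%N; rewrite coefB coef1 /=.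
      move=> /(in_idealDKr im (in_idealN im _)) mm1; apply: m1; apply: mm1.
      exact: (in_idealMr imX h mK).
    have [k [K' [_ K'k sK' mKK']]] := truncate_mod im Kn.
    have gn : ~ poly_ideal m g by move=> /(_ i).
    have [j [g' [_ g'j sg' mgg']]] := truncate_mod im gn.
    (* After truncation, [K' * (1 + g' * 'X)] has a coefficient outside [m] in the positive degree
       [k + j + 1], so it cannot be [1] modulo [m]. *)
    have : poly_ideal m (1 - K' * (1 + g' * 'X)).
      have -> : 1 - K' * (1 + g' * 'X) =
        (1 - K * h) + (K - K') * h + K' * (g - g') * 'X by rewrite /h; ring.
      apply: (in_idealD imX (in_idealD imX Kh (in_idealMr imX _ mKK'))).
      exact: (in_idealMr imX _ (in_idealMl imX _ mgg')).
    move=> /(_ (k + j).+1); rewrite coefB coef1 /= sub0r mulrDr mulr1 mulrA coefD.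
    rewrite nth_default; last by apply: leq_trans sK' _; rewrite ltnS leq_addr.
    rewrite add0r coefMX /= => /(in_idealN im); rewrite opprK coefM.
    have kj : (k < (k + j).+1)%N by rewrite ltnS leq_addr.
    rewrite (bigD1 (Ordinal kj)) //= addKn big1 ?addr0; first exact: prime_mul.
    move=> l lNk; have [kl|lk] := ltnP k l.
      by rewrite nth_default ?mul0r //; apply: leq_trans kl.
    rewrite [g'`_ _]nth_default ?mulr0 //; apply: leq_trans sg' _.
    have : l != k :> nat by rewrite -val_eqE in lNk.
    by move: lk; lia.
  have [M mM' hM] := maximal_above (noetherian_poly noethA) (ideal_adjP h imX) nW1.
  have [iM M1 _] := mM'; exists M; split=> //.
    rewrite -QE; apply: subset_trans hM; apply: subset_trans (@ideal_adj_sub _ _ _).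
    by move=> F pF j; apply/pm/pF.
  move=> Mg; apply: M1; have Mh : M h by apply: hM; apply: ideal_adj_gen.
  by apply: (in_idealDKr iM _ Mh); apply: in_idealMr.
have [c [pc [b [d [Qb cE]]]]] := algebraic_divides_constant pQ QF nF Qg.
have [k [G [_ Gk sG pFG]]] := truncate_mod ip nF.
have QG : Q G by rewrite -(subKr F G); exact: (in_idealB iQ QF (pQ_sub _ pFG)).
have [m [mm pm mcG]] := jacA p _ pp (prime_mul pp pc Gk).
have pm' := maximal_prime mm; have [im m1 maxm] := mm.
have [|Q1 [pQ1 QQ1 Q1m]] := @going_up_poly Q m G k pQ pm' pm QG _ sG.
  by move=> mG; apply: mcG; apply: in_idealMl.
have [iQ1 Q11 _] := pQ1.
have [M mM Q1M] := maximal_above (noetherian_poly noethA) iQ1 Q11.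
have [iM M1 _] := mM; exists M; split=> //; first exact: subset_trans Q1M.
move=> Mg; apply: mcG; apply: in_idealMr => //.
(* The contraction of [M] is a proper ideal containing [m], which is maximal. *)
have <- : polyC @^-1` M = m.
  apply: maxm => //; first exact: preimage_ideal.
  by rewrite -Q1m => a; apply: Q1M.
rewrite /preimage /= cE; apply: in_idealD => //; first by apply/Q1M/QQ1.
exact: in_idealMl.
Qed.

End PolynomialPrimes.

(** * Finitely generated extensions *)

Section Surjection.
Variables (T B : comNzRingType) (h : {rmorphism T -> B}).
Hypothesis h_surj : forall b, exists a, h a = b.

Lemma noetherian_surj : noetherian T -> noetherian B.
Proof.
move=> /noetherianP noethT; apply/noetherianP => I iI.
have [s [sI sP]] := noethT _ (preimage_ideal h iI).
exists [seq h x | x <- s]; split=> [_ /mapP[x /sI Ix ->] //|J iJ sJ b Ib].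
have [a ab] := h_surj b; rewrite -ab in Ib *.
apply: (sP _ (preimage_ideal h iJ)) => // x xs.
by apply: sJ; apply: map_f.
Qed.

Lemma image_ideal (I : set T) : is_ideal I -> is_ideal (h @` I).
Proof.
move=> iI; split.
- by exists 0; [exact: in_ideal0|exact: rmorph0].
- move=> _ _ [x Ix <-] [y Iy <-]; exists (x + y); last exact: rmorphD.
  exact: in_idealD.
- move=> b _ [x Ix <-]; have [a <-] := h_surj b.
  by exists (a * x); [exact: in_idealMl|exact: rmorphM].
Qed.

Lemma preimage_image (I : set T) : is_ideal I -> (forall x, h x = 0 -> I x) ->
  h @^-1` (h @` I) = I.
Proof.
move=> iI kI; apply/seteqP; split=> x; last by exists x.
move=> [y Iy yx]; rewrite -(subrK y x); apply: in_idealD => //.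
by apply: kI; rewrite rmorphB yx subrr.
Qed.

Lemma image_prime (P : set T) : prime_ideal P -> (forall x, h x = 0 -> P x) ->
  prime_ideal (h @` P).
Proof.
move=> [iP P1 PM] kP; split; first exact: image_ideal.
  by rewrite -(rmorph1 h) => h1; apply: P1; rewrite -(preimage_image iP kP).
move=> x y; have [a <-] := h_surj x; have [b <-] := h_surj y.
rewrite -rmorphM => hab.
have /PM[Pa|Pb] : P (a * b) by rewrite -(preimage_image iP kP).
  by left; exists a.
by right; exists b.
Qed.

Lemma jacobson_surj : jacobson T -> jacobson B.
Proof.
move=> /jacobsonP jacT; apply/jacobsonP => P f pP Pf.
have [g gf] := h_surj f; rewrite -gf in Pf.
have [M [[iM M1 maxM] PM Mg]] := jacT _ g (preimage_prime h pP) Pf.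
have [iP _ _] := pP.
have kM x : h x = 0 -> M x.
  by move=> hx; apply: PM; rewrite /preimage /= hx; apply: in_ideal0.
have PI := preimage_image iM kM; exists (h @` M); split.
- split; first exact: image_ideal.
    by rewrite -(rmorph1 h) => h1; apply: M1; rewrite -PI.
  move=> J iJ J1 MJ; have <- : h @^-1` J = M.
    apply: maxM; first exact: preimage_ideal.
      by rewrite /preimage /= rmorph1.
    by move=> x Mx; apply: MJ; exists x.
  apply/seteqP; split=> [b Jb|_ [x Jx <-] //].
  by have [a ab] := h_surj b; exists a => //; rewrite /preimage /= ab.
- move=> b Pb; have [a ab] := h_surj b; exists a => //.
  by apply: PM; rewrite /preimage /= ab.
- by rewrite -gf => hg; apply: Mg; rewrite -PI.
Qed.

(** Every [P i] contains the contraction of [Q], hence the kernel of [h], so its image is a prime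
    that contracts back to it. *)
Lemma lifts_chains_surj : lifts_chains h.
Proof.
move=> Q g pQ; have [f <-] := h_surj g => Qf; exists f; split=> // n P [pP sP] P0 Pn.
have [iQ _ _] := pQ.
have P_sub i : (i <= n)%N -> P 0%N `<=` P i.
  elim: i => [|i IH] i_n //.
  by apply: subset_trans (IH (ltnW i_n)) _; case: (sP i i_n).
have kP i x : (i <= n)%N -> h x = 0 -> P i x.
  move=> i_n hx; apply: (P_sub i i_n); rewrite P0 /preimage /= hx.
  exact: in_ideal0.
have PI i : (i <= n)%N -> h @^-1` (h @` P i) = P i.
  move=> i_n; apply: preimage_image => [|x]; last exact: kP.
  exact: prime_is_ideal (pP i i_n).
exists (fun i => h @` P i); split=> //.
- split=> i i_n; first by apply: image_prime => [|x]; [exact: pP|exact: kP].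
  have [PS nPS] := sP i i_n; split; first exact: image_subset.
  by move=> S_P; apply: nPS; rewrite -(PI i (ltnW i_n)) -(PI _ i_n) => x /S_P.
- rewrite P0; apply/seteqP; split=> [_ [x Qx <-] //|b Qb].
  by have [a ab] := h_surj b; exists a => //; rewrite /preimage /= ab.
- by rewrite -(PI n) // in Pn.
Qed.

End Surjection.

Lemma lifts_chains_comp (A B C : comNzRingType) (phi : A -> B)
    (psi : {rmorphism B -> C}) :
  lifts_chains phi -> lifts_chains psi -> lifts_chains (psi \o phi).
Proof.
move=> lphi lpsi Q g pQ Qg.
have [f [Qf fP]] := lpsi Q g pQ Qg.
have [e [Qe eP]] := lphi _ f (preimage_prime psi pQ) Qf.
exists e; split=> // n P cP P0 Pn.
have [Ps [cPs Ps0 PsP Psf]] := eP n P cP P0 Pn.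
have [Qs [cQs Qs0 QsP Qsg]] := fP n Ps cPs Ps0 Psf.
exists Qs; split=> // i i_n; rewrite -PsP // -QsP //.
Qed.

(** * Subrings and images of morphisms *)

Section SubringType.
Variables (B : comNzRingType) (S : set B) (cS : subring_closed [in S]).

(* The closedness proof is an argument only so that the instance below can be
   found from the predicate. *)
Definition subring_pred of subring_closed [in S] : pred B := [in S].
Local Notation Sp := (subring_pred cS).
HB.instance Definition _ := GRing.isSubringClosed.Build B Sp cS.

Definition subring_type := {x : B | Sp x}.
HB.instance Definition _ := [isSub of subring_type for @sval _ _].
HB.instance Definition _ := [Choice of subring_type by <:].
HB.instance Definition _ := [SubChoice_isSubComNzRing of subring_type by <:].

End SubringType.

Lemma range_subring (T B : comNzRingType) (h : {rmorphism T -> B}) :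
  subring_closed [in range h].
Proof.
split=> [|_ _ /set_mem[x _ <-] /set_mem[y _ <-]|_ _ /set_mem[x _ <-] /set_mem[y _ <-]];
  apply: mem_set.
- by exists 1 => //; exact: rmorph1.
- by exists (x - y) => //; exact: rmorphB.
- by exists (x * y) => //; exact: rmorphM.
Qed.

Lemma rmorphism_image (T B : comNzRingType) (h : {rmorphism T -> B}) :
  exists (S : comNzRingType) (ev : {rmorphism T -> S}) (i : {rmorphism S -> B}),
    [/\ injective i, forall b, exists a, ev a = b & forall a, i (ev a) = h a].
Proof.
pose S : comNzRingType := subring_type (range_subring h).
have hS a : subring_pred (range_subring h) (h a) by apply: mem_set; exists a.
pose ev a : S := exist _ (h a) (hS a).
have evB : GRing.zmod_morphism ev by move=> x y; apply: val_inj; exact: rmorphB.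
have evM : GRing.monoid_morphism ev.
  by split=> [|x y]; apply: val_inj; [exact: rmorph1|exact: rmorphM].
pose ev' : {rmorphism T -> S} := HB.pack ev
  (GRing.isZmodMorphism.Build T S ev evB) (GRing.isMonoidMorphism.Build T S ev evM).
exists S, ev', (val : {rmorphism S -> B}); split=> //; first exact: val_inj.
move=> [b Sb]; have [a _ ab] := set_mem Sb.
by exists a; apply: val_inj.
Qed.

Lemma subring_adjoin (A B : comNzRingType) (phi : {rmorphism A -> B}) (t : B) :
  exists (S : comNzRingType) (ev : {rmorphism {poly A} -> S})
    (i : {rmorphism S -> B}),
    [/\ injective i, forall b, exists a, ev a = b,
      forall a, i (ev a%:P) = phi a & i (ev 'X) = t].
Proof.
have cphi : commr_rmorph phi t by move=> x; apply: mulrC.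
have [S [ev [i [inj_i surj_ev iE]]]] := rmorphism_image (horner_morph cphi).
exists S, ev, i; split=> // [a|]; rewrite iE.
  exact: horner_morphC.
exact: horner_morphX.
Qed.

(** * Adjoining finitely many elements *)

Definition generated_by (R C : comPzRingType) (phi : R -> C) (s : seq C) : Prop :=
  forall S : set C, subring_closed [in S] -> (forall r, S (phi r)) ->
    (forall x, x \in s -> S x) -> S = setT.

(** Induction on the generators: [phi] factors as [A -> {poly A} -> S -> C], where [S] adjoins [t]
    to the image of [A] and the remaining generators generate [C] over [S]. With none left, [phi] is
    surjective. *)
Lemma fg_noetherian_lifts (A C : comNzRingType) (phi : {rmorphism A -> C})
    (g : seq C) :
  generated_by phi g -> noetherian A -> noetherian C /\ lifts_chains phi.
Proof.
elim: g A phi => [|t g IH] A phi gen noethA.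
  have phi_surj b : exists a, phi a = b.
    have : range phi b.
      by by rewrite (gen (range phi)) //; exact: range_subring.
    by move=> [a _ ab]; exists a.
  by split; [exact: noetherian_surj noethA|exact: lifts_chains_surj].
have [S [ev [i [inj_i ev_surj iC iX]]]] := subring_adjoin phi t.
have noethS : noetherian S := noetherian_surj ev_surj (noetherian_poly noethA).
have [|noethC lifts_i] := IH S i _ noethS.
  move=> U cU Ui Ug; apply: gen => // [a|x]; first by rewrite -iC.
  by rewrite inE => /orP[/eqP ->|/Ug //]; rewrite -iX.
split=> //; rewrite (_ : phi = i \o (ev \o polyC) :> (A -> C)); last first.
  by apply/funext => a /=; rewrite iC.
apply: lifts_chains_comp lifts_i; apply: lifts_chains_comp.
  exact: lifts_chains_polyC.
exact: lifts_chains_surj.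
Qed.

(** Starting from the image of [R], the elements are adjoined one at a time; each stage is a
    quotient of a polynomial ring over the previous one, whereas [A] itself need not be
    Noetherian. *)
Lemma fg_subring_containing (R A : comNzRingType) (phi : {rmorphism R -> A})
    (s : seq A) : noetherian R -> jacobson R ->
  exists (A0 : comNzRingType) (phi0 : {rmorphism R -> A0})
    (i : {rmorphism A0 -> A}),
    [/\ injective i, forall r, i (phi0 r) = phi r, noetherian A0, jacobson A0
      & forall x, x \in s -> exists a, i a = x].
Proof.
move=> noethR jacR; elim: s => [|x s [A0 [phi0 [i [inj_i iE noeth0 jac0 is_s]]]]].
  have [S [ev [i [inj_i ev_surj iE]]]] := rmorphism_image phi.
  exists S, ev, i; split=> //; first exact: noetherian_surj noethR.
  exact: jacobson_surj jacR.
have [S [ev [i' [inj_i' ev_surj iC iX]]]] := subring_adjoin i x.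
exists S, (ev \o (polyC \o phi0) : {rmorphism R -> S}), i'; split=> //.
- by move=> r; rewrite /= iC.
- exact: noetherian_surj (noetherian_poly noeth0).
- exact: jacobson_surj (jacobson_poly noeth0 jac0).
- move=> y; rewrite inE => /orP[/eqP ->|/is_s[a <-]]; first by exists (ev 'X).
  by exists (ev a%:P).
Qed.

(** Links the final statement, which allows the zero ring, to the theory over [comNzRingType]; being
    an equality, it can be substituted. *)
Lemma comNzRing_of_neq0 (A : comPzRingType) :
  (1 : A) <> 0 -> exists A' : comNzRingType, A = A'.
Proof.
case: A => T cl n1.
have n1' : (1 : GRing.ComPzRing.Pack cl) != 0 by apply/eqP.
pose A' : comNzRingType := HB.pack (GRing.ComPzRing.sort (GRing.ComPzRing.Pack cl))
  (@GRing.PzSemiRing_isNonZero.Build (GRing.ComPzRing.Pack cl) n1').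
by exists A'.
Qed.

(** * Transfer of prime chains from [A] to [B] *)

Lemma prime_chain_transfer (R A C : comNzRingType) (B : comPzRingType)
    (phiA : {rmorphism R -> A}) (psi : {rmorphism R -> C})
    (incl : {rmorphism A -> B}) (j : {rmorphism B -> C}) n :
  noetherian R -> jacobson R -> fg_algebra psi ->
  (forall r, j (incl (phiA r)) = psi r) -> injective incl -> injective j ->
  has_prime_chain A n -> has_prime_chain B n.
Proof.
move=> noethR jacR [sC genC] psiE inj_incl inj_j [P [pP sP]].
have [a aP] : {a & forall i, (i < n)%N -> P i.+1 (a i) /\ ~ P i (a i)}.
  apply: (choice (P := fun i x => (i < n)%N -> P i.+1 x /\ ~ P i x)) => i.
  have [i_n|] := boolP (i < n)%N; last by exists 0.
  by have [_ /existsNP[x /not_implyP[PSx Px]]] := sP i i_n; exists x.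
have [A0 [phi0 [i [inj_i iE noeth0 jac0 i_a]]]] :=
  fg_subring_containing phiA [seq a k | k <- iota 0 n] noethR jacR.
pose chi : {rmorphism A0 -> C} := j \o (incl \o i).
have inj_chi : injective chi by move=> x y /inj_j/inj_incl/inj_i.
have chiE r : chi (phi0 r) = psi r by rewrite /chi /= iE psiE.
have [noethC lifts_chi] : noetherian C /\ lifts_chains chi.
  apply: (fg_noetherian_lifts (g := sC)) => // S cS Schi SsC.
  by apply: genC => // r; rewrite -chiE.
pose p k := i @^-1` (P k).
have pp k : (k <= n)%N -> prime_ideal (p k) by move=> /pP; apply: preimage_prime.
have sp k : (k < n)%N -> p k `<` p k.+1.
  move=> k_n; have [PS _] := sP k k_n; split=> [x|]; first exact: PS.
  have [PSa Pa] := aP k k_n.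
  have [|b bE] := i_a (a k); first by apply: map_f; rewrite mem_iota.
  by rewrite -bE in PSa Pa; move=> /(_ b PSa).
have [p0ideal p01 p0M] := pp 0%N (leq0n n).
(* As [chi] is injective, the zero ideal misses the image of the complement of [p 0]; a prime of [C]
   still missing it contracts into [p 0]. *)
have [|||Q [pQ _ Qp _]] := @prime_disjoint C noethC [set 0] (chi @` (~` p 0%N)).
- by split=> [|x y -> ->|c x ->] //=; rewrite ?addr0 ?mulr0.
- split; first by exists 1; rewrite ?rmorph1.
  move=> _ _ [x px <-] [y py <-]; exists (x * y); last exact: rmorphM.
  by move=> /p0M[].
- move=> _ -> [x px x0]; apply: px; rewrite (_ : x = 0); first exact: in_ideal0.
  by apply: inj_chi; rewrite rmorph0.
have Qp0 : chi @^-1` Q `<=` p 0%N.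
  by move=> x Qx; apply: contrapT => px; apply: (Qp _ Qx); exists x.
pose q k := if k is 0 then chi @^-1` Q else p k.
have cq : prime_chain n q.
  split=> [[_|k] //|[|k] k_n]; [exact: preimage_prime|exact: pp| |exact: sp].
  have [p01_sub np10] := sp 0%N k_n.
  split; first exact: subset_trans p01_sub.
  by move=> p1Q; apply: np10; apply: subset_trans Qp0.
have [_ Q1 _] := pQ.
(* Nothing has to be avoided in [C], hence the choice [g = 1]. *)
have [f [Qf fP]] := lifts_chi Q 1 pQ Q1.
have [q' [cq' q'0 q'f]] := prime_chain_avoiding noeth0 jac0 cq Qf.
have [Qs [[pQs sQs] _ QsP _]] := fP n q' cq' q'0 q'f.
exists (fun k => j @^-1` (Qs k)); split=> k k_n.
  exact: preimage_prime (pQs k k_n).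
have [QS _] := sQs k k_n; split=> [x|SQ]; first exact: QS.
(* An equality in [B] would contract to one in [A0], where [q'] is strict. *)
have [_ []] := cq'.2 k k_n; rewrite -(QsP _ k_n) -(QsP _ (ltnW k_n)) => x.
exact: SQ.
Qed.

Local Close Scope classical_set_scope.

Theorem corollary4p7 (R : comPzRingType)
  (R_noetherian : noetherian R) (R_jacobson : jacobson R)
  (A B : comPzRingType)
  (phiA : {rmorphism R -> A}) (phiB : {rmorphism R -> B})
  (A_subfinite : subfinite phiA) (B_subfinite : subfinite phiB)
  (incl : {rmorphism A -> B})
  (incl_inj : injective incl)
  (incl_alg : forall r : R, incl (phiA r) = phiB r) :
  (krull_dim A <= krull_dim B)%E.
Proof.
have nz_R : (1 : A) <> 0 -> (1 : R) <> 0.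
  by move=> A1 R1; apply: A1; rewrite -(rmorph1 phiA) R1 rmorph0.
have chains n : has_prime_chain A n -> has_prime_chain B n.
  move=> chainA; have [P [pP _]] := chainA.
  (* A prime of [A] forces [A] to be nonzero, and then so are [R] and [C]. *)
  have A1 : (1 : A) <> 0.
    by move=> A1; have [[P0 _ _] P1 _] := pP 0%N (leq0n n); apply: P1; rewrite A1.
  have R1 := nz_R A1.
  have [C [psi [j [fgC jE inj_j]]]] := B_subfinite.
  have C1 : (1 : C) <> 0.
    move=> C1; apply/A1/incl_inj/inj_j.
    by rewrite !rmorph1 C1 !rmorph0.
  have jinclE r : j (incl (phiA r)) = psi r by rewrite incl_alg jE.
  clear A_subfinite B_subfinite nz_R incl_alg jE.
  have [A' AE] := comNzRing_of_neq0 A1; subst A.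
  have [R' RE] := comNzRing_of_neq0 R1; subst R.
  have [C' CE] := comNzRing_of_neq0 C1; subst C.
  exact: prime_chain_transfer fgC jinclE incl_inj inj_j chainA.
have [_ lubA] := krull_dimP A; have [ubB _] := krull_dimP B.
apply: lubA => _ [n chainA <-]; apply: ubB; exists n => //.
exact: chains.
Qed.
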